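(* Let $m\geqslant 3$ be an integer. If $n$ is an integer with $n \geqslant 2m^3 - \frac{1}{2}m^2 - m + 1$, then the complete bipartite graph $K_{m,n}$ does not belong to $B_{2m-3}^{m}$, i.e. $K_{m,n}$ has no monotonic $(2m-3)$-bend EPG representation. (In the symbol $B_{\ell}^{m}$ the superscript $m$ stands for ''monotonic'' and is not the integer $m$.)
   Context: All graphs are finite and simple. $K_{m,n}$ is the complete bipartite graph with partition classes of sizes $m$ and $n$. A grid consists of horizontal grid lines (rows, increasing from bottom to top) and vertical grid lines (columns, increasing from left to right). A grid point is a crossing of two grid lines. A grid edge is the part of a grid line between two consecutive grid points. A path on a grid consists of two grid points (its end points) and a number of consecutive grid edges connecting them. A bend of a path is a turn of the path at a grid point. An EPG representation of a graph $G$ assigns to each vertex $v$ of $G$ a path $P_v$ on a common grid such that two distinct vertices $v,w$ are adjacent in $G$ if and only if $P_v$ and $P_w$ share at least one grid edge. A path is monotonic if it is ascending in both columns and rows, i.e. it has the shape of a staircase going upwards from left to right. For a nonnegative integer $\ell$, $B_\ell^m$ (the superscript $m$ is just a symbol for ''monotonic'') is the class of all graphs that have an EPG representation in which every path is monotonic and has at most $\ell$ bends. *)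

(* Defs.v *)
From HB Require Import structures.
From mathcomp Require Import all_boot all_order all_algebra.

Set Implicit Arguments.
Unset Strict Implicit.
Unset Printing Implicit Defensive.

Record sgraph := SGraph {
  vertex :> finType;
  adj : rel vertex;
  adj_sym : symmetric adj;
  adj_irrefl : irreflexive adj
}.

Definition Kbip_adj (m n : nat) : rel ('I_m + 'I_n) :=
  fun u v => match u, v with
             | inl _, inr _ | inr _, inl _ => true
             | _, _ => false
             end.

Lemma Kbip_adj_sym m n : symmetric (@Kbip_adj m n).
Proof. by case=> ? [] ?. Qed.

Lemma Kbip_adj_irrefl m n : irreflexive (@Kbip_adj m n).
Proof. by case. Qed.

Definition Kbip (m n : nat) : sgraph :=
  SGraph (@Kbip_adj_sym m n) (@Kbip_adj_irrefl m n).

(* Grid with c columns and r rows; the point (i, j) is the crossing of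
   column i (counted from the left) and row j (counted from the bottom). *)
Definition gpoint (c r : nat) : finType := ('I_c * 'I_r)%type.

Section GridPaths.
Variables c r : nat.
Implicit Types (x y : gpoint c r) (p q : seq (gpoint c r)).

Definition col_of x : nat := x.1.
Definition row_of x : nat := x.2.

Definition grid_adj x y : bool :=
  (row_of x == row_of y) && ((col_of y == (col_of x).+1) || (col_of x == (col_of y).+1)) ||
  (col_of x == col_of y) && ((row_of y == (row_of x).+1) || (row_of x == (row_of y).+1)).

(* A path is the sequence of the grid points it visits, from one end point to
   the other. *)
Definition grid_path p : bool := (p != [::]) && sorted grid_adj p.

Definition consecutive (T : Type) (s : seq T) : seq (T * T) := zip s (behead s).

Definition grid_edges p : seq {set gpoint c r} :=
  [seq [set e.1; e.2] | e <- consecutive p].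

Definition share_edge p q : Prop :=
  exists2 e, e \in grid_edges p & e \in grid_edges q.

Definition horizontal (e : gpoint c r * gpoint c r) : bool :=
  row_of e.1 == row_of e.2.

(* Number of pairs of consecutive steps of which exactly one is horizontal. *)
Definition bends p : nat :=
  count (fun ef => horizontal ef.1 != horizontal ef.2)
        (consecutive (consecutive p)).

(* Since edges are unordered, reversing a path changes neither its edges nor
   its bends, so it is no restriction that a staircase is listed starting from
   its lower left end point. *)
Definition monotonic p : bool :=
  sorted (fun x y => (col_of x <= col_of y) && (row_of x <= row_of y)) p.

End GridPaths.

Definition epg_representation (G : sgraph) (c r : nat)
    (P : G -> seq (gpoint c r)) : Prop :=
  (forall v, grid_path (P v)) /\
  (forall v w, v != w -> (adj v w <-> share_edge (P v) (P w))).

Definition B_mon (l : nat) (G : sgraph) : Prop :=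
  exists (c r : nat) (P : G -> seq (gpoint c r)),
    epg_representation P /\
    (forall v, monotonic (P v) /\ bends (P v) <= l).

(* Main.v *)
(* Let p_1, ..., p_m and q_1, ..., q_n be the paths of the two partition classes;
   each has at most 2m-2 segments.  At most 4m(m-1) of the q_j contain the first
   or last edge of a segment of some p_i.  For any other q_j, each segment of q_j
   that meets p_i lies on p_i, so the m paths p_i use m different segments among
   the 2m-2 of q_j; two of these are consecutive, and q_j turns from some p_i into
   some p_i' at a common point of both.  As the q_j are edge-disjoint, (i, i') and
   this point determine j.  Along the successive crossings of two staircases the
   sum of the two segment numbers strictly increases and has constant parity, so
   there are at most 2m-3 crossings if both start in the same direction and 2m-2
   otherwise.  At most m^2/2 ordered pairs start in different directions, hence
   n <= 4m(m-1) + m(m-1)(2m-3) + m^2/2 = 2m^3 - m^2/2 - m. *)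
Require Import Defs.
From mathcomp Require Import all_boot all_order all_algebra.
From mathcomp Require Import zify lra.

Set Implicit Arguments.
Unset Strict Implicit.
Unset Printing Implicit Defensive.

Import GRing.Theory Num.Theory.

(** * Indexing lists of consecutive pairs *)

Lemma size_consecutive (T : Type) (s : seq T) :
  size (consecutive s) = (size s).-1.
Proof. by rewrite size_zip size_behead; lia. Qed.

Lemma nth_consecutive (T : Type) (x : T) (s : seq T) k :
  k.+1 < size s -> nth (x, x) (consecutive s) k = (nth x s k, nth x s k.+1).
Proof.
move=> hk; rewrite nth_zip_cond -/(consecutive s) size_consecutive nth_behead.
by case: ltnP => //; lia.
Qed.

Lemma mem_consecutive (T : eqType) (x : T) (s : seq T) k :
  k.+1 < size s -> (nth x s k, nth x s k.+1) \in consecutive s.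
Proof.
by move=> hk; rewrite -nth_consecutive //; apply: mem_nth; rewrite size_consecutive; lia.
Qed.

(** * Edges of staircases and their shared edges *)

Section Staircases.
Variables (c r : nat) (x0 : gpoint c r).
Implicit Types (p q : seq (gpoint c r)) (i j k l : nat).

Local Notation pt p k := (nth x0 p k).

Definition dir p k : bool := horizontal (pt p k, pt p k.+1).

(** The index, counted from 0, of the segment containing the [k]-th edge. *)
Definition seg p k : nat :=
  count (fun ef => horizontal ef.1 != horizontal ef.2)
        (take k (consecutive (consecutive p))).

(** Booleans are read as 0 or 1, so every step is a unit step to the right or upwards, in a form
    suited to linear arithmetic. *)
Definition staircase p : Prop := forall k, k.+1 < size p ->
  col_of (pt p k.+1) = col_of (pt p k) + dir p k /\
  row_of (pt p k.+1) = row_of (pt p k) + ~~ dir p k.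

(** An edge of a staircase is determined by its lower left end and its direction, so this is
    equality of two edges. *)
Definition meet p q k l : bool :=
  [&& k.+1 < size p, l.+1 < size q, pt p k == pt q l & dir p k == dir q l].

Definition first_of_seg p k : bool := (k == 0) || (dir p k.-1 != dir p k).

(** A path with [size p] points has edges 0 to [size p - 2], so the first disjunct singles out its
    final edge. *)
Definition last_of_seg p k : bool :=
  (size p <= k.+2) || (dir p k != dir p k.+1).

Lemma point_eq (x y : gpoint c r) :
  col_of x = col_of y -> row_of x = row_of y -> x = y.
Proof.
by case: x y => [a b] [a' b'] /= ha hb; congr pair; apply: val_inj.
Qed.

Lemma monotonic_staircase p : grid_path p -> monotonic p -> staircase p.
Proof.
case/andP=> _ /(sortedP x0) adjp /(sortedP x0) mon k hk.
have := adjp k hk; have := mon k hk.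
rewrite /dir /horizontal /grid_adj /=.
by case: (eqVneq (row_of (pt p k))) => /=; lia.
Qed.

Lemma share_edge_meet p q : staircase p -> staircase q ->
  share_edge p q <-> exists k l, meet p q k l.
Proof.
move=> sp sq; split=> [[e] | [k [l /and4P[hk hl /eqP ept /eqP edir]]]].
- move=> /(nthP set0)[k]; rewrite size_map size_consecutive => hk <-.
  rewrite (nth_map (x0, x0)) ?size_consecutive // nth_consecutive; last lia.
  move=> /(nthP set0)[l]; rewrite size_map size_consecutive => hl.
  rewrite (nth_map (x0, x0)) ?size_consecutive // nth_consecutive; last lia.
  move=> /= /setP eset; exists k, l.
  have hk' : k.+1 < size p by lia.
  have hl' : l.+1 < size q by lia.
  have [c1 r1] := sp k hk'; have [c2 r2] := sq l hl'.
  have e1 := eset (pt p k); have e2 := eset (pt p k.+1).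
  rewrite !inE eqxx ?orbT in e1; rewrite !inE eqxx ?orbT in e2.
  (* Only the second of the four matchings of end points survives: two collapse an edge to a point,
     and one reverses it, although every step goes right or up. *)
  case/orP: e1 => /eqP e1; case/orP: e2 => /eqP e2.
  + by move: c1 r1; rewrite e1 e2; case: (dir p k) => /= *; lia.
  + by rewrite /meet hk' hl' e1 eqxx /dir e1 e2 eqxx.
  + by move: c1 r1 c2 r2; rewrite e1 e2; case: (dir p k); case: (dir q l) => /= *; lia.
  + by move: c1 r1; rewrite e1 e2; case: (dir p k) => /= *; lia.
- have [c1 r1] := sp k hk; have [c2 r2] := sq l hl.
  have ept' : pt p k.+1 = pt q l.+1 by apply: point_eq; rewrite ?c1 ?c2 ?r1 ?r2 ept edir.
  exists [set pt p k; pt p k.+1].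
  + apply/mapP; exists (pt p k, pt p k.+1) => //.
    exact: mem_consecutive.
  + apply/mapP; exists (pt q l, pt q l.+1); last by rewrite ept ept'.
    exact: mem_consecutive.
Qed.

(** * Segment numbers along a staircase *)

Lemma seg0 p : seg p 0 = 0.
Proof. by rewrite /seg take0. Qed.

Lemma segS p k : k.+2 < size p ->
  seg p k.+1 = seg p k + (dir p k != dir p k.+1).
Proof.
move=> hk; rewrite /seg (take_nth ((x0, x0), (x0, x0))); last first.
  by rewrite !size_consecutive !ltn_predRL.
rewrite -cats1 count_cat /= addn0 nth_consecutive ?size_consecutive ?ltn_predRL //.
by rewrite !nth_consecutive //= (ltn_trans _ hk).
Qed.

Lemma seg_bends p k : seg p k <= bends p.
Proof.
rewrite /seg /bends -{2}(cat_take_drop k (consecutive (consecutive p))).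
by rewrite count_cat leq_addr.
Qed.

Lemma seg_mono p k l : k <= l -> l.+1 < size p -> seg p k <= seg p l.
Proof.
elim: l => [|l IH]; first by rewrite leqn0 => /eqP ->.
rewrite leq_eqVlt => /orP[/eqP -> // | hkl] hl.
by rewrite segS // (leq_trans (IH _ _)) ?leq_addr //; lia.
Qed.

(** Each bend switches the direction, so the parity of the segment number records whether the
    initial direction has changed. *)
Lemma odd_seg p k : k.+1 < size p -> odd (seg p k) = dir p 0 (+) dir p k.
Proof.
elim: k => [|k IH] hk; first by rewrite seg0 addbb.
rewrite segS // oddD IH; last lia.
by case: (dir p 0); case: (dir p k); case: (dir p k.+1).
Qed.

Lemma dir_seg p k l : k <= l -> l.+1 < size p -> seg p k = seg p l ->
  dir p k = dir p l.
Proof.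
elim: l => [|l IH]; first by rewrite leqn0 => /eqP ->.
rewrite leq_eqVlt => /orP[/eqP -> // | hkl] hl; rewrite segS // => es.
have := @seg_mono p k l; rewrite -ltnS hkl => /(_ isT (ltnW hl)) le_s.
have /eqP <- : dir p l == dir p l.+1 by move: es; case: eqP => //=; lia.
by apply: IH => //; lia.
Qed.

Lemma seg_position p k l : staircase p -> k <= l -> l.+1 < size p ->
  seg p k = seg p l ->
  col_of (pt p l) = col_of (pt p k) + dir p k * (l - k) /\
  row_of (pt p l) = row_of (pt p k) + ~~ dir p k * (l - k).
Proof.
move=> sp; elim: l => [|l IH].
  by rewrite leqn0 => /eqP ->; rewrite !muln0 !addn0.
rewrite leq_eqVlt => /orP[/eqP -> | hkl] hl.
  by rewrite subnn !muln0 !addn0.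
move=> es.
have es' : seg p k = seg p l.
  have /= := @seg_mono p k l hkl (ltnW hl).
  have := segS hl; case: eqP => //=; lia.
have [-> ->] := sp l (ltnW hl).
have [-> ->] := IH hkl (ltnW hl) es'.
rewrite -(@dir_seg p k l hkl (ltnW hl) es').
by case: (dir p k) => /=; lia.
Qed.

Lemma staircase_height p k : staircase p -> k < size p ->
  col_of (pt p k) + row_of (pt p k) = col_of (pt p 0) + row_of (pt p 0) + k.
Proof.
move=> sp; elim: k => [|k IH] hk; first by rewrite addn0.
have [-> ->] := sp k hk.
by have := IH (ltnW hk); case: (dir p k) => /=; lia.
Qed.

(** A later edge that opens a segment has a larger segment number. Hence a path, a segment number
    and the choice of first or last name a single edge. *)
Lemma seg_first_inj p k k' : k.+1 < size p -> k'.+1 < size p ->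
  first_of_seg p k -> first_of_seg p k' -> seg p k = seg p k' -> k = k'.
Proof.
wlog lt_k : k k' / k < k'.
  by case: (ltngtP k k') => // lt_k H *; [|symmetry]; apply: H.
case: k' lt_k => // k' lt_k hk hk' _; rewrite /first_of_seg /= segS //.
move=> ->; have := @seg_mono p k k' lt_k (ltnW hk'); lia.
Qed.

Lemma seg_last_inj p k k' : k.+1 < size p -> k'.+1 < size p ->
  last_of_seg p k -> last_of_seg p k' -> seg p k = seg p k' -> k = k'.
Proof.
wlog lt_k : k k' / k < k'.
  by case: (ltngtP k k') => // lt_k H *; [|symmetry]; apply: H.
move=> hk hk'; rewrite /last_of_seg leqNgt (leq_ltn_trans _ hk') //= => dk _.
have := @seg_mono p k.+1 k' lt_k hk'; rewrite segS ?dk; lia.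
Qed.

(* Then a maximal straight run of [q] that shares an edge with [p] lies entirely
   on [p]. *)
Definition contained_runs p q : Prop :=
  forall k l, meet p q k l -> ~~ first_of_seg p k /\ ~~ last_of_seg p k.

(** * Following a straight run of one path along another *)

(** The shared edge does not end its segment of [p], so [p] goes straight on together with [q]. *)
Lemma meet_next p q k l : staircase p -> staircase q -> contained_runs p q ->
  meet p q k l -> l.+2 < size q -> dir q l = dir q l.+1 -> meet p q k.+1 l.+1.
Proof.
move=> sp sq int mkl hl dq; have [_] := int k l mkl.
case/and4P: mkl => hk hl' /eqP ept /eqP edir.
rewrite /last_of_seg negb_or -ltnNge negbK => /andP[hk' /eqP dp].
have [c1 r1] := sp k hk; have [c2 r2] := sq l hl'.
rewrite /meet hk' hl -dp -dq edir eqxx andbT /=.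
by apply/eqP/point_eq; rewrite ?c1 ?c2 ?r1 ?r2 ept edir.
Qed.

Lemma meet_prev p q k l : staircase p -> staircase q -> contained_runs p q ->
  meet p q k l.+1 -> dir q l = dir q l.+1 -> meet p q k.-1 l.
Proof.
move=> sp sq int mkl dq; have [+ _] := int k l.+1 mkl.
case/and4P: mkl => hk hl /eqP ept /eqP edir.
rewrite /first_of_seg negb_or negbK; case: k hk ept edir => //= k hk ept edir.
move=> /eqP dp.
have [c1 r1] := sp k (ltnW hk); have [c2 r2] := sq l (ltnW hl).
have dpq : dir p k = dir q l by rewrite dp edir dq.
rewrite /meet (ltnW hk) (ltnW hl) dpq eqxx andbT /=.
apply/eqP/point_eq.
- by apply/eqP; rewrite -(eqn_add2r (dir p k)) -c1 ept c2 dpq.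
- by apply/eqP; rewrite -(eqn_add2r (~~ dir p k)) -r1 ept r2 dpq.
Qed.

Lemma seg_between p i j k : i <= j -> j <= k -> k.+1 < size p ->
  seg p i = seg p k -> seg p i = seg p j /\ seg p j = seg p k.
Proof.
move=> hij hjk hk es.
have := @seg_mono p i j hij; have := @seg_mono p j k hjk hk; lia.
Qed.

Lemma meet_run_right p q k l l' : staircase p -> staircase q ->
  contained_runs p q -> meet p q k l -> l <= l' -> l'.+1 < size q ->
  seg q l = seg q l' -> exists k', meet p q k' l'.
Proof.
move=> sp sq int mkl; elim: l' => [|l' IH].
  by rewrite leqn0 => /eqP <- *; exists k.
rewrite leq_eqVlt => /orP[/eqP <- * | hl]; first by exists k.
move=> hl' es; have [es1 es2] := @seg_between q l l' l'.+1 hl (leqnSn l') hl' es.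
have [k' mk] := IH hl (ltnW hl') es1.
by exists k'.+1; apply: meet_next => //; apply: dir_seg.
Qed.

Lemma meet_run_left p q k l l' : staircase p -> staircase q ->
  contained_runs p q -> meet p q k l -> l' <= l ->
  seg q l' = seg q l -> exists k', meet p q k' l'.
Proof.
move=> sp sq int; elim: l k => [|l IH] k mkl.
  by rewrite leqn0 => /eqP ->; exists k.
rewrite leq_eqVlt => /orP[/eqP -> * | hl es]; first by exists k.
have /and4P[_ hl1 _ _] := mkl.
have [es1 es2] := @seg_between q l' l l.+1 hl (leqnSn l) hl1 es.
by apply: (IH k.-1) => //; apply: meet_prev => //; apply: dir_seg.
Qed.

(** A discrete intermediate value argument: the segment number grows by at most one per edge, so the
    increase happens at a single bend. *)
Lemma seg_step p k l : k <= l -> l.+1 < size p -> seg p l = (seg p k).+1 ->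
  exists j, [/\ k <= j, j < l, seg p j = seg p k, seg p j.+1 = seg p l &
                dir p j != dir p j.+1].
Proof.
elim: l => [|l IH].
  by rewrite leqn0 => /eqP -> _ /eqP; rewrite eq_sym -addn1 -{2}[seg p 0]addn0 eqn_add2l.
rewrite leq_eqVlt => /orP[/eqP -> | hkl] hl es; first by lia.
have := segS hl; case: eqP => /= [d | d] es'.
  have [|j [h1 h2 h3 h4 h5]] := IH hkl (ltnW hl); first lia.
  by exists j; split=> //; lia.
by exists l; split=> //; [lia | apply/eqP].
Qed.

(* The [k1]-th edge of [p1] followed by the [k2]-th edge of [p2] is a bend: here
   a path can turn from [p1] into [p2]. *)
Definition corner p1 p2 k1 k2 : Prop :=
  [/\ k1.+1 < size p1, k2.+1 < size p2, pt p1 k1.+1 = pt p2 k2 &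
      dir p1 k1 != dir p2 k2].

(** * Corners between two staircases *)

(** Both shared edges can be moved along their segments of [q] to the bend between these segments,
    where [q] arrives on [p1] and leaves on [p2]. *)
Lemma corner_exists p1 p2 q k1 k2 l1 l2 :
  staircase p1 -> staircase p2 -> staircase q ->
  contained_runs p1 q -> contained_runs p2 q ->
  meet p1 q k1 l1 -> meet p2 q k2 l2 -> seg q l2 = (seg q l1).+1 ->
  exists k1' k2' l, corner p1 p2 k1' k2' /\ meet p1 q k1' l.
Proof.
move=> s1 s2 sq i1 i2 m1 m2 es.
have /and4P[_ h1 _ _] := m1; have /and4P[_ h2 _ _] := m2.
have le_l : l1 <= l2.
  by rewrite leqNgt; apply/negP => /ltnW /seg_mono /(_ h1); lia.
have [l [hl1 hl2 e1 e2 dl]] := seg_step le_l h2 es.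
have hl : l.+1 < size q by lia.
have [k1' m1'] := meet_run_right s1 sq i1 m1 hl1 hl (esym e1).
have [k2' m2'] := meet_run_left s2 sq i2 m2 hl2 e2.
exists k1', k2', l; split=> //.
case/and4P: m1' => hk1 _ /eqP p1E /eqP d1E.
case/and4P: m2' => hk2 _ /eqP p2E /eqP d2E.
split; rewrite ?d1E ?d2E // p2E.
have [c1 r1] := s1 k1' hk1; have [c2 r2] := sq l hl.
by apply: point_eq; rewrite ?c1 ?c2 ?r1 ?r2 p1E d1E.
Qed.

(** The two edges at a corner are perpendicular, so by [odd_seg] the parity depends on the initial
    directions only. *)
Lemma odd_corner p1 p2 k1 k2 : corner p1 p2 k1 k2 ->
  odd (seg p1 k1 + seg p2 k2) = ~~ (dir p1 0 (+) dir p2 0).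
Proof.
case=> h1 h2 _; rewrite oddD !odd_seg //.
by case: (dir p1 0); case: (dir p2 0); case: (dir p1 k1); case: (dir p2 k2).
Qed.

(** The sum is at most [2 * b]; for equal initial directions it is odd, which saves one value of the
    half. *)
Lemma corner_half_bound p1 p2 k1 k2 b : bends p1 <= b -> bends p2 <= b ->
  corner p1 p2 k1 k2 ->
  (seg p1 k1 + seg p2 k2)./2 < b + (dir p1 0 != dir p2 0).
Proof.
move=> b1 b2 /odd_corner.
have := seg_bends p1 k1; have := seg_bends p2 k2.
by case: (dir p1 0); case: (dir p2 0) => /=; lia.
Qed.

(* Two staircases move weakly forward along both segment sequences from one
   corner to the next; staying on both segments is impossible, since these are
   perpendicular.  Halving the sum loses nothing, as its parity is constant. *)
Lemma corner_half_inj p1 p2 k1 k2 k1' k2' : staircase p1 -> staircase p2 ->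
  corner p1 p2 k1 k2 -> corner p1 p2 k1' k2' ->
  (seg p1 k1 + seg p2 k2)./2 = (seg p1 k1' + seg p2 k2')./2 -> k1 = k1'.
Proof.
move=> s1 s2; wlog lt_k : k1 k2 k1' k2' / k1 < k1'.
  case: (ltngtP k1 k1') => // lt_k H C C' E; first exact: H E.
  by symmetry; apply: H (esym E).
move=> C C' eh.
have es : seg p1 k1 + seg p2 k2 = seg p1 k1' + seg p2 k2'.
  by rewrite -[LHS]odd_double_half -[RHS]odd_double_half eh !odd_corner.
case: C => h1 h2 e d; case: C' => h1' h2' e' d'.
(* Column plus row grows by one per step, so between two common points both paths advance by the
   same number of edges. *)
have H1 := staircase_height s1 h1; have H2 := staircase_height s2 (ltnW h2).
have H1' := staircase_height s1 h1'; have H2' := staircase_height s2 (ltnW h2').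
rewrite e in H1; rewrite e' in H1'.
have lt_k2 : k2 < k2' by lia.
have es1 := seg_mono (ltnW lt_k) h1'; have es2 := seg_mono (ltnW lt_k2) h2'.
have E1 : seg p1 k1 = seg p1 k1' by lia.
have E2 : seg p2 k2 = seg p2 k2' by lia.
have [c1 r1] := seg_position s1 (ltnW lt_k) h1' E1.
have [c2 r2] := seg_position s2 (ltnW lt_k2) h2' E2.
have [c3 r3] := s1 _ h1; have [c4 r4] := s1 _ h1'.
have D1 := dir_seg (ltnW lt_k) h1' E1.
move: c1 r1 c2 r2 c3 r3 c4 r4 d; rewrite e e' -D1.
by case: (dir p1 k1); case: (dir p2 k2) => //=; lia.
Qed.

End Staircases.

(** * Counting and the final contradiction *)

(** With [t] true values the double sum is [2 * t * (m - t)]; the bound is then the inequality of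
    arithmetic and geometric means. *)
Lemma two_colour_pairs m (D : 'I_m -> bool) :
  2 * \sum_(i < m) \sum_(j < m) (D i != D j) <= m ^ 2.
Proof.
pose t := #|[set i | D i]|.
have cD : \sum_(i < m) D i = t.
  by rewrite /t -sum1_card [RHS]big_mkcond; apply: eq_bigr => i _; rewrite inE; case: (D i).
have cN : \sum_(i < m) ~~ D i = m - t.
  have: \sum_(i < m) (D i + ~~ D i) = m.
    by rewrite -[RHS]card_ord -sum1_card; apply: eq_bigr => i _; case: (D i).
  by rewrite big_split /= cD; lia.
have t_le : t <= m by rewrite -[leqRHS]card_ord max_card.
rewrite (eq_bigr (fun i => D i * (m - t) + ~~ D i * t)).
  rewrite big_split /= -!big_distrl /= cD cN.
  by have := nat_AGM2 t (m - t); rewrite subnKC // => -[+ _]; lia.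
move=> i _; case: (D i) => /=; rewrite ?mul1n ?mul0n ?addn0 ?add0n -?cN -?cD;
  by apply: eq_bigr => j _; case: (D j).
Qed.

Theorem theorem2p8 (m n : nat) (hm : (3 <= m)%N)
  (hn : (2 * m%:R ^+ 3 - 1 / 2 * m%:R ^+ 2 - m%:R + 1 <= n%:R :> rat)%R) :
  ~ B_mon (2 * m - 3) (Kbip m n).
Proof.
case=> c [r [P [[pathP adjP] monP]]].
(* The hypothesis doubled, with negative terms moved across to avoid truncated subtraction. *)
have {}hn : 4 * m ^ 3 + 2 <= 2 * n + m ^ 2 + 2 * m.
  rewrite -(ler_nat rat) !natrD !natrM; lra.
have m_gt0 : 0 < m by lia.
have x0 : gpoint c r.
  by have := pathP (inl (Ordinal m_gt0)); case: (P _).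
pose p (i : 'I_m) := P (inl i); pose q (j : 'I_n) := P (inr j).
have st v : staircase x0 (P v).
  by apply: monotonic_staircase => //; case: (monP v).
have bp i : bends (p i) <= 2 * m - 3 by case: (monP (inl i)).
have bq j : bends (q j) <= 2 * m - 3 by case: (monP (inr j)).
have hit i j : exists k l, meet x0 (p i) (q j) k l.
  apply/(share_edge_meet (st _) (st _)).
  have ne : (inl i : Kbip m n) != inr j by [].
  by have [H _] := adjP _ _ ne; apply: H.
have disjp i i' k k' : meet x0 (p i) (p i') k k' -> i = i'.
  move=> M; apply/eqP; case: eqVneq => // ne.
  have ne' : (inl i : Kbip m n) != inl i' by apply: contraNneq ne => -[->].
  have [_ H] := adjP _ _ ne'.
  by suff: false by []; apply: H; apply/(share_edge_meet (st _) (st _)); exists k, k'.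
have disjq j j' l l' : meet x0 (q j) (q j') l l' -> j = j'.
  move=> M; apply/eqP; case: eqVneq => // ne.
  have ne' : (inr j : Kbip m n) != inr j' by apply: contraNneq ne => -[->].
  have [_ H] := adjP _ _ ne'.
  by suff: false by []; apply: H; apply/(share_edge_meet (st _) (st _)); exists l, l'.
have meet_trans i j j' k l l' : meet x0 (p i) (q j) k l ->
    meet x0 (p i) (q j') k l' -> j = j'.
  move=> /and4P[_ h1 /eqP e1 /eqP d1] /and4P[_ h2 /eqP e2 /eqP d2].
  by apply: (disjq _ _ l l'); rewrite /meet h1 h2 -e1 -e2 -d1 -d2 !eqxx.
pose D i := dir x0 (p i) 0.
(* Labels charged to the [q j]: either the first or last edge of a segment of some [p i], or an
   ordered pair of paths with the half sum of segment numbers at a corner. *)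
pose T := (('I_m * bool * 'I_(2 * m - 2)) + ('I_m * 'I_m * 'I_(2 * m - 2)))%type.
pose spec (j : 'I_n) (t : T) : Prop := match t with
  | inl (i, b, s) => exists k l, [/\ meet x0 (p i) (q j) k l,
      (if b then first_of_seg else last_of_seg) c r x0 (p i) k & seg (p i) k = s]
  | inr (i, i', h) => [/\ i != i', h < 2 * m - 3 + (D i != D i') &
     exists k k' l, [/\ corner x0 (p i) (p i') k k', meet x0 (p i) (q j) k l &
       (seg (p i) k + seg (p i') k')./2 = h]]
  end.
(* A label fixes one edge of [p i], and edge-disjointness leaves only one [q j] through that
   edge. *)
have spec_inj j j' t : spec j t -> spec j' t -> j = j'.
  case: t => [[[i b] s] | [[i i'] h]] /=.
  - move=> [k [l [M fk ek]]] [k' [l' [M' fk' ek']]].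
    have /and4P[hk _ _ _] := M; have /and4P[hk' _ _ _] := M'.
    suff e : k = k' by rewrite e in M; exact: meet_trans M M'.
    by case: b fk fk' => f f'; [apply: seg_first_inj f f' _ | apply: seg_last_inj f f' _];
      rewrite // ek.
  - move=> [_ _ [k1 [k2 [l [C M e]]]]] [_ _ [k1' [k2' [l' [C' M' e']]]]].
    have ek : k1 = k1' by apply: (corner_half_inj _ _ C C'); rewrite ?e ?e' //; apply: st.
    by rewrite ek in M; exact: meet_trans M M'.
have spec_ex j : exists t, spec j t.
  pose good i k l := meet x0 (p i) (q j) k l ==>
    (~~ first_of_seg x0 (p i) k && ~~ last_of_seg x0 (p i) k).
  have [/forallP G | ] :=
    boolP [forall i, forall k : 'I_(size (p i)), forall l : 'I_(size (q j)), good i k l].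
  - have cr i : contained_runs x0 (p i) (q j).
      move=> k l M; have /and4P[hk hl _ _] := M.
      have /forallP/(_ (Ordinal (ltnW hk)))/forallP/(_ (Ordinal (ltnW hl))) := G i.
      by rewrite /good /= M => /andP.
    have [K HK] := fin_all_exists (fun i => hit i j).
    have [L HL] := fin_all_exists HK.
    (* Grouping the segments of [q j] as (0,1), (2,3), and so on gives [m - 1] groups, so two of the
       [m] paths fall into the same group. *)
    have segL i : (seg (q j) (L i))./2 < m.-1.
      have := seg_bends (q j) (L i); have := bq j; lia.
    have [i [i' [ne es]]] : exists i i' : 'I_m,
        i != i' /\ (seg (q j) (L i))./2 = (seg (q j) (L i'))./2.
      have [/injectiveP inj | /injectivePn[i [i' ne /(congr1 val) es]]] :=
        boolP (injectiveb (fun i => Ordinal (segL i))); last by exists i, i'.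
      by have := leq_card _ inj; rewrite !card_ord; lia.
    wlog le_s : i i' ne es / seg (q j) (L i) <= seg (q j) (L i').
      move=> H; case: (leqP (seg (q j) (L i)) (seg (q j) (L i'))) => [|/ltnW] le_s.
        exact: (H i i').
      by apply: (H i' i); rewrite // eq_sym.
    (* If both paths meet the same segment of [q j], then [p i] also contains the edge shared with
       [p i'], against disjointness; otherwise the two segments are consecutive. *)
    have [eqs | nes] := eqVneq (seg (q j) (L i)) (seg (q j) (L i')).
      have /and4P[_ h _ _] := HL i; have /and4P[_ h' _ _] := HL i'.
      have [k' M'] : exists k', meet x0 (p i) (q j) k' (L i').
        have [le_L | /ltnW le_L] := leqP (L i) (L i').
          exact: meet_run_right (st _) (st _) (cr i) (HL i) le_L h' eqs.
        exact: meet_run_left (st _) (st _) (cr i) (HL i) le_L (esym eqs).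
      case/negP: ne; apply/eqP.
      case/and4P: M' => h1 _ /eqP e1 /eqP d1; have /and4P[h2 _ /eqP e2 /eqP d2] := HL i'.
      by apply: (disjp _ _ k' (K i')); rewrite /meet h1 h2 e1 e2 d1 d2 !eqxx.
    have es' : seg (q j) (L i') = (seg (q j) (L i)).+1 by lia.
    have [k1 [k2 [l [C M]]]] :=
      corner_exists (st _) (st _) (st _) (cr i) (cr i') (HL i) (HL i') es'.
    have hb := corner_half_bound (bp i) (bp i') C.
    have hb' : (seg (p i) k1 + seg (p i') k2)./2 < 2 * m - 2.
      by apply: leq_trans hb _; case: (_ != _); lia.
    by exists (inr (i, i', Ordinal hb')); split=> //; exists k1, k2, l.
  - rewrite negb_forall => /existsP[i]; rewrite negb_forall => /existsP[k].
    rewrite negb_forall => /existsP[l]; rewrite negb_imply negb_and !negbK.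
    case/andP=> M H.
    have hs : seg (p i) k < 2 * m - 2.
      have := seg_bends (p i) k; have := bp i; lia.
    case/orP: H => H.
    + by exists (inl (i, true, Ordinal hs)), k, l.
    + by exists (inl (i, false, Ordinal hs)), k, l.
have [f Hf] := fin_all_exists spec_ex.
have f_inj : injective f.
  by move=> j j' e; apply: (spec_inj _ _ (f j)) => //; rewrite e.
(* The part of [spec] that does not mention [j], so that labels can be counted. *)
pose admissible (t : T) : bool := match t with
  | inl _ => true
  | inr (i, i', h) => (i != i') && (h < 2 * m - 3 + (D i != D i')) end.
pose A := [set t | admissible t].
have n_le : n <= #|A|.
  rewrite -[leqLHS]card_ord -(card_imset _ f_inj); apply: subset_leq_card.
  apply/subsetP => _ /imsetP[j _ ->]; rewrite inE; have := Hf j.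
  by case: (f j) => [// | [[i i'] h] /= [-> ->]].
have A_card : #|A| <= m * 2 * (2 * m - 2) +
    \sum_(i < m) \sum_(j < m | i != j) (2 * m - 3 + (D i != D j)).
  rewrite -sum1_card big_mkcond big_sumType /=.
  apply: leq_add.
    apply: (@leq_trans (\sum_(t : 'I_m * bool * 'I_(2 * m - 2)) 1)).
      by apply: leq_sum => t _; case: (_ \in _).
    by rewrite sum1_card !card_prod !card_ord card_bool.
  rewrite pair_big_dep [leqRHS]big_mkcond /=.
  have -> : \sum_(t : 'I_m * 'I_m * 'I_(2 * m - 2)) (if inr t \in A then 1 else 0) =
    \sum_(ij : 'I_m * 'I_m) \sum_(h < 2 * m - 2) (if inr (ij, h) \in A then 1 else 0).
    by rewrite pair_big /=; apply: eq_bigr => -[].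
  apply: leq_sum => -[i j] _ /=.
  case: (eqVneq i j) => [-> | ne].
    by rewrite big1 // => h _; rewrite inE /= eqxx.
  rewrite (eq_bigr (fun h : 'I_(2 * m - 2) =>
     if h < 2 * m - 3 + (D i != D j) then 1 else 0)); last first.
    by move=> h _; rewrite inE /= ne.
  have le_h : 2 * m - 3 + (D i != D j) <= 2 * m - 2 by case: (_ != _); lia.
  by rewrite -big_mkcond /= (big_ord_narrow le_h) sum1_card card_ord.
have := two_colour_pairs D.
have E : \sum_(i < m) \sum_(j < m | i != j) (2 * m - 3 + (D i != D j)) =
   m * ((m - 1) * (2 * m - 3)) + \sum_(i < m) \sum_(j < m) (D i != D j).
  rewrite (_ : m * _ = \sum_(i < m) (m - 1) * (2 * m - 3)); last first.
    by rewrite sum_nat_const card_ord.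
  rewrite -big_split /=; apply: eq_bigr => i _.
  rewrite [X in _ = _ + X](bigD1 i) //= eqxx add0n.
  rewrite (eq_bigl (fun j => j != i)) => [|j]; last by rewrite eq_sym.
  rewrite big_split /= sum_nat_const; congr (_ * _ + _).
  by rewrite cardC1 card_ord subn1.
(* Doubling the count gives [2 * n] at most [4 * m ^ 3 - m ^ 2 - 2 * m], which is 2 below what [hn]
   demands. *)
nia.
Qed.
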